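(* Let $n \geq 1$ and $p=(p_1,\ldots,p_n) \in (0,1)^n$ with $\sum_{i=1}^n p_i < 1$, and set $p_0 = 1-\sum_{i=1}^n p_i$. Let $u=(1/n,\ldots,1/n)$ and $v=(v_1,\ldots,v_n)$ with $v_i = (1-p_0)/n$ for all $i$. Then for all $c=1,\ldots,n$, $$T_{c,n}(u) \leq_{\rm st} T_{c,n}(v) \leq_{\rm st} T_{c,n}(p).$$
   Context: For a vector $q=(q_1,\ldots,q_n)$ with nonnegative entries and $\sum_{i=1}^n q_i \leq 1$, set $q_0 = 1-\sum_{i=1}^n q_i$. At each discrete time $1,2,\ldots$ a coupon is drawn independently, with replacement, from $\{0,1,\ldots,n\}$, coupon $i$ being drawn with probability $q_i$ (coupon $0$ is a ''null coupon'' that never counts toward the collection). For $1 \leq c \leq n$, $T_{c,n}(q)$ denotes the number of draws needed until, for the first time, $c$ distinct coupons among $\{1,\ldots,n\}$ have been obtained. (Thus for $u$ the null coupon has probability $0$, while for $v$ it has probability $p_0$.) For real random variables $X,Y$, $X \leq_{\rm st} Y$ means $\Pr\{X>t\} \leq \Pr\{Y>t\}$ for all real $t$. *)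

(* Defs.v *)
From HB Require Import structures.
From mathcomp Require Import all_boot all_order all_algebra.
From mathcomp Require Import all_classical all_reals all_analysis.

Set Implicit Arguments.
Unset Strict Implicit.
Unset Printing Implicit Defensive.

Import Order.TTheory GRing.Theory Num.Theory.

Local Open Scope classical_set_scope.
Local Open Scope ring_scope.

Definition null_prob (R : realType) (n : nat) (q : 'I_n -> R) : R :=
  1 - \sum_(i < n) q i.

(* Coupons are the elements of 'I_n.+1: ord0 is the null coupon, and
   lift ord0 i (of value i + 1) is the i-th genuine coupon, i : 'I_n. *)
Definition coupon_prob (R : realType) (n : nat) (q : 'I_n -> R)
    (j : 'I_n.+1) : R :=
  if unlift ord0 j is Some i then q i else null_prob q.

(* The target type E is meant to be finite and carries the discrete
   sigma-algebra, so that the A j are arbitrary subsets of E. *)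
Definition mutually_independent (d : measure_display) (Omega : measurableType d)
    (R : realType) (P : probability Omega R) (I : eqType) (E : Type)
    (X : I -> Omega -> E) : Prop :=
  forall (J : seq I) (A : I -> set E), uniq J ->
    P (\bigcap_(j in [set` J]) (X j @^-1` A j)) =
    (\prod_(j <- J) P (X j @^-1` A j))%E.

(* X k is the coupon drawn at time k + 1. *)
Definition coupon_draws (d : measure_display) (Omega : measurableType d)
    (R : realType) (P : probability Omega R) (n : nat) (q : 'I_n -> R)
    (X : nat -> Omega -> 'I_n.+1) : Prop :=
  [/\ forall (k : nat) (A : set 'I_n.+1), measurable (X k @^-1` A),
      forall (k : nat) (j : 'I_n.+1),
        P (X k @^-1` [set j]) = (coupon_prob q j)%:E
    & mutually_independent P X].

Definition collected (Omega : Type) (n : nat) (X : nat -> Omega -> 'I_n.+1)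
    (t : nat) (w : Omega) : {set 'I_n} :=
  [set i : 'I_n | [exists k : 'I_t, X k w == lift ord0 i]]%SET.

(* Equal to +oo on the outcomes for which c distinct coupons are never
   obtained. *)
Definition collection_time (R : realType) (Omega : Type) (n : nat) (c : nat)
    (X : nat -> Omega -> 'I_n.+1) (w : Omega) : \bar R :=
  ereal_inf [set (t%:R)%:E | t in [set t : nat | (c <= #|collected X t w|)%N]].

(* X and Y may live on different probability spaces. *)
Definition st_le (R : realType)
    (d1 : measure_display) (Omega1 : measurableType d1)
    (P1 : probability Omega1 R) (X : Omega1 -> \bar R)
    (d2 : measure_display) (Omega2 : measurableType d2)
    (P2 : probability Omega2 R) (Y : Omega2 -> \bar R) : Prop :=
  forall t : R,
    (P1 [set w | t%:E < X w] <= P2 [set w | t%:E < Y w])%E.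

(* Main.v *)
Require Import Defs.
From HB Require Import structures.
From mathcomp Require Import all_boot all_order all_algebra.
From mathcomp Require Import all_classical all_reals all_analysis.
From mathcomp Require Import ring lra.

Set Implicit Arguments.
Unset Strict Implicit.
Unset Printing Implicit Defensive.

Import Order.TTheory GRing.Theory Num.Theory.

Local Open Scope classical_set_scope.
Local Open Scope ring_scope.

(* P(T_{c,n}(q) > m) satisfies a recursion on the first draw, with state the
   set S of coupons already held; call it F_m(S). Since F_m decreases in S,
   moving mass from the null coupon to the others decreases it, which compares
   u with v.
   For v against p, move two probabilities q_i <= q_j closer to each other with
   fixed sum. With D_i = F_m(S + i) - F_m(S + i + j), one gets by induction on m,
   for all r at once, that q_i^r D_i + q_j^r D_j decreases: the recursion turns
   the exponent r into r + 1, and for m = 0 this is the convexity of x^r.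
   Finitely many such moves, each setting one more coordinate to the mean, lead
   from p to v. *)

(* [S] is the set of coupons already collected, [m] the number of draws left. *)
Fixpoint survival (R : realType) (n : nat) (q : 'I_n -> R) (c m : nat)
    (S : {set 'I_n}) : R :=
  if m is m'.+1 then
    null_prob q * survival q c m' S +
    \sum_(i < n) q i * survival q c m' (i |: S)%SET
  else (#|S| < c)%:R.

(** * Monotonicity of the survival function *)

Section Survival.
Variables (R : realType) (n c : nat).
Implicit Types (q : 'I_n -> R) (S : {set 'I_n}) (m : nat).

Lemma survival_subset q m S S' :
    (forall i, 0 <= q i) -> 0 <= null_prob q -> (S \subset S')%SET ->
  survival q c m S' <= survival q c m S.
Proof.
move=> q0 nq0; elim: m S S' => [|m IHm] S S' sSS' /=.
  rewrite ler_nat; have := subset_leq_card sSS'.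
  by case: (ltnP #|S'| c) => // S'c SS'; rewrite (leq_ltn_trans SS').
apply: lerD; first by rewrite ler_wpM2l ?IHm.
by apply: ler_sum => i _; rewrite ler_wpM2l ?IHm // finset.setUS.
Qed.

(** Raising the probabilities moves mass from the null coupon, which keeps [S], to coupons that
    enlarge [S] and hence lower the survival. *)
Lemma survival_le_prob q q' m S :
    (forall i, 0 <= q i <= q' i) -> 0 <= null_prob q' ->
  survival q' c m S <= survival q c m S.
Proof.
move=> qq' nq'0.
have q0 i : 0 <= q i by case/andP: (qq' i).
have le_qq' i : q i <= q' i by case/andP: (qq' i).
have nq0 : 0 <= null_prob q.
  by apply: le_trans nq'0 _; rewrite lerD2l lerN2 ler_sum.
elim: m S => [//|m IHm] S /=.
(* Only the law of the first draw changes here; the later draws still follow [q], and the induction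
   hypothesis handles them afterwards. *)
have le_step : null_prob q' * survival q c m S +
    \sum_i q' i * survival q c m (i |: S)%SET <=
    null_prob q * survival q c m S +
    \sum_i q i * survival q c m (i |: S)%SET.
  rewrite -subr_ge0 /null_prob.
  set s := survival q c m S.
  rewrite (_ : _ - _ = \sum_i (q' i - q i) * (s - survival q c m (i |: S)%SET)).
    apply: sumr_ge0 => i _; rewrite mulr_ge0 ?subr_ge0 //.
    by apply: survival_subset; rewrite ?finset.subsetU1.
  rewrite [RHS](eq_bigr (fun i => q' i * s - q i * s +
    (q i * survival q c m (i |: S)%SET - q' i * survival q c m (i |: S)%SET))); last first.
    by move=> i _; ring.
  by rewrite !big_split /= !sumrN -!mulr_suml; ring.
apply: le_trans le_step.
apply: lerD; first by rewrite ler_wpM2l.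
by apply: ler_sum => i _; rewrite ler_wpM2l // (le_trans (q0 i)).
Qed.

Lemma exprD_le_spread (a b x y : R) (r : nat) :
    0 <= b -> b <= x <= a -> b <= y <= a -> x + y = a + b ->
  x ^+ r + y ^+ r <= a ^+ r + b ^+ r.
Proof.
move=> b0; wlog leyx : x y / y <= x => [wl bx bb e|].
  have [yx|/ltW xy] := leP y x; first exact: wl.
  by rewrite [x ^+ r + _]addrC; apply: wl => //; rewrite addrC.
move=> /andP[bx xa] /andP[by_ ya] e.
elim: r => [|r IHr]; first by rewrite !expr0.
have y0 : 0 <= y by exact: le_trans by_.
have x0 : 0 <= x by exact: le_trans leyx.
have a0 : 0 <= a by exact: le_trans xa.
have xyr : y ^+ r <= x ^+ r by rewrite lerXn2r ?nnegrE.
have xar : x ^+ r <= a ^+ r by rewrite lerXn2r ?nnegrE.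
rewrite !exprS -subr_ge0.
(* With b <= y <= x <= a, the first three summands are nonnegative, the first by induction; the last
   vanishes since x + y = a + b. *)
have -> : a * a ^+ r + b * b ^+ r - (x * x ^+ r + y * y ^+ r) =
  b * (a ^+ r + b ^+ r - (x ^+ r + y ^+ r)) + (a - b) * (a ^+ r - x ^+ r) +
  (a - x) * (x ^+ r - y ^+ r) + (a + b - (x + y)) * y ^+ r by ring.
rewrite e subrr mul0r addr0.
by rewrite !addr_ge0 // mulr_ge0 ?subr_ge0 // (le_trans bx).
Qed.

(** * Moving two probabilities closer to each other *)

Section Spread.
Variables (q q' : 'I_n -> R) (i j : 'I_n).
Hypothesis ij : i != j.
Hypothesis q0 : forall k, 0 <= q k.
Hypothesis nq0 : 0 <= null_prob q.
Hypothesis eq_q : forall k, k != i -> k != j -> q' k = q k.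
Hypothesis eq_sum : q' i + q' j = q i + q j.
Hypothesis q'i : q i <= q' i <= q j.
Hypothesis q'j : q i <= q' j <= q j.

Let sum_pair (f : 'I_n -> R) :
  \sum_k f k = f i + f j + \sum_(k | (k != i) && (k != j)) f k.
Proof. by rewrite (bigD1 i) //= (bigD1 j) 1?eq_sym //= addrA. Qed.

Lemma null_prob_spread : null_prob q' = null_prob q.
Proof.
rewrite /null_prob !sum_pair eq_sum; congr (_ - (_ + _)).
by apply: eq_bigr => k /andP[/eq_q h /h].
Qed.

(** When both coupons are held, drawing either one leaves [S] unchanged, so only the sum [q i + q j]
    enters the recursion. *)
Lemma survival_spread_mem m S :
  i \in S -> j \in S -> survival q' c m S = survival q c m S.
Proof.
elim: m S => [//|m IHm] S iS jS /=.
rewrite null_prob_spread !sum_pair.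
have -> : (i |: S = S)%SET by apply/finset.setUidPr; rewrite finset.sub1set.
have -> : (j |: S = S)%SET by apply/finset.setUidPr; rewrite finset.sub1set.
rewrite IHm // -!mulrDl eq_sum; congr (_ + (_ + _)).
apply: eq_bigr => k /andP[ki kj]; rewrite eq_q // IHm //.
  by rewrite !inE iS orbT.
by rewrite !inE jS orbT.
Qed.

Let both S := (i |: (j |: S))%SET.

(* The recursion [gapS] closes up because, in each difference, drawing the
   missing coupon of the pair sends both terms to [both S], where they cancel. *)
Let gap (f : 'I_n -> R) m S (r : nat) :=
  f i ^+ r * (survival f c m (i |: S)%SET - survival f c m (both S)) +
  f j ^+ r * (survival f c m (j |: S)%SET - survival f c m (both S)).

Let gapS (f : 'I_n -> R) m S r : gap f m.+1 S r =
  null_prob f * gap f m S r + gap f m S r.+1 +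
  \sum_(k | (k != i) && (k != j)) f k * gap f m (k |: S)%SET r.
Proof.
rewrite /gap /= !sum_pair.
have -> : (i |: (i |: S) = i |: S)%SET by rewrite finset.setUA finset.setUid.
have -> : (j |: (j |: S) = j |: S)%SET by rewrite finset.setUA finset.setUid.
have -> : (j |: (i |: S) = both S)%SET by rewrite finset.setUCA.
have -> : (i |: (j |: S) = both S)%SET by [].
have -> : (i |: both S = both S)%SET.
  by rewrite /both finset.setUA finset.setUid.
have -> : (j |: both S = both S)%SET.
  by rewrite /both finset.setUCA (finset.setUA [set j]%SET) finset.setUid.
rewrite [X in _ = _ + X](eq_bigr (fun k =>
  f i ^+ r * (f k * survival f c m (k |: (i |: S))%SET) -
  f i ^+ r * (f k * survival f c m (k |: both S)%SET) +
  (f j ^+ r * (f k * survival f c m (k |: (j |: S))%SET) -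
  f j ^+ r * (f k * survival f c m (k |: both S)%SET)))); last first.
  move=> k _; rewrite /both !(finset.setUCA _ [set k]%SET).
  by ring.
rewrite !big_split /= !sumrN -!mulr_sumr.
(* Drawing the coupon of the pair that is already held contributes the extra factor [f i] or [f j],
   which raises the exponent. *)
by rewrite !exprS; ring.
Qed.

Lemma gap_spread m S r : i \notin S -> j \notin S ->
  gap q' m S r <= gap q m S r.
Proof.
elim: m S r => [|m IHm] S r iS jS.
  (* With no draws left, both differences equal the same nonnegative number, which factors out and
     leaves a comparison of sums of powers. *)
  rewrite /gap /= !cardsU1 !inE (negbTE ij) (negbTE iS) (negbTE jS) /=.
  rewrite -!mulrDl ler_wpM2r //; last first.
    by rewrite [leRHS]addrC exprD_le_spread // eq_sum addrC.
  rewrite subr_ge0 ler_nat; case: (ltnP (1 + (1 + #|S|)) c) => // h.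
  by rewrite (leq_ltn_trans _ h).
rewrite !gapS null_prob_spread; apply: lerD; first apply: lerD.
- by rewrite ler_wpM2l ?IHm.
- exact: IHm.
apply: ler_sum => k /andP[ki kj]; rewrite eq_q // ler_wpM2l // IHm //.
  by rewrite !inE eq_sym (negbTE ki).
by rewrite !inE eq_sym (negbTE kj).
Qed.

Lemma survival_spread m S : i \notin S -> j \notin S ->
  survival q' c m S <= survival q c m S.
Proof.
elim: m S => [//|m IHm] S iS jS /=.
rewrite null_prob_spread !sum_pair; apply: lerD.
  by rewrite ler_wpM2l ?IHm.
apply: lerD; last first.
  apply: ler_sum => k /andP[ki kj]; rewrite eq_q // ler_wpM2l // IHm //.
    by rewrite !inE eq_sym (negbTE ki).
  by rewrite !inE eq_sym (negbTE kj).
(* The contribution of the pair is the gap with exponent 1 plus a term in [both S], and that term is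
   the same for [q] and [q']. *)
have E f : f i * survival f c m (i |: S)%SET + f j * survival f c m (j |: S)%SET
   = gap f m S 1 + (f i + f j) * survival f c m (both S).
  by rewrite /gap !expr1; ring.
rewrite !E eq_sum survival_spread_mem ?inE ?eqxx ?orbT //.
by rewrite lerD2r gap_spread.
Qed.

End Spread.

(** * Equalizing all probabilities *)

(** Induction on the number of coordinates that differ from the mean [mu]: unless all agree, one
    lies below and one above, and a move of this pair sets one of them to [mu]. *)
Lemma survival_uniform q (mu : R) m :
    (forall i, 0 <= q i) -> 0 <= null_prob q -> \sum_(i < n) q i = n%:R * mu ->
  survival (fun _ : 'I_n => mu) c m finset.set0 <= survival q c m finset.set0.
Proof.
have [k] := ubnP #|[set i | q i != mu]|%SET.
elim: k q => // k IHk q; rewrite ltnS => card_q q0 nq0 sum_q.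
have sum_mu : \sum_(i < n) (q i - mu) = 0.
  by rewrite big_split /= sumr_const card_ord sum_q mulr_natl mulNrn subrr.
have [i qi|q_ge] := pickP (fun i => q i < mu); last first.
  suff -> : q = fun=> mu by [].
  apply/funext => i; apply/eqP; rewrite -subr_eq0.
  have : \sum_(i < n) (q i - mu) == 0 by rewrite sum_mu.
  rewrite psumr_eq0 => [/allP/(_ i)|j _].
    by rewrite mem_index_enum => /(_ isT).
  by rewrite subr_ge0 leNgt q_ge.
have [j qj|q_le] := pickP (fun j => mu < q j); last first.
  suff : \sum_(i < n) (q i - mu) < 0 by rewrite sum_mu ltxx.
  rewrite (bigD1 i) //= -[ltRHS]addr0 ltr_leD // ?subr_lt0 //.
  by apply: sumr_le0 => j _; rewrite subr_le0 leNgt q_le.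
have ij : i != j by apply/eqP => ij; move: qi; rewrite ij ltNge ltW.
have step x y : x + y = q i + q j -> q i <= x <= q j -> q i <= y <= q j ->
    (x == mu) || (y == mu) ->
    survival (fun _ : 'I_n => mu) c m finset.set0 <=
    survival q c m finset.set0.
  move=> xy hx hy xymu.
  pose q' k := if k == i then x else if k == j then y else q k.
  have q'i : q' i = x by rewrite /q' eqxx.
  have q'j : q' j = y by rewrite /q' eq_sym (negbTE ij) eqxx.
  have q'E l : l != i -> l != j -> q' l = q l by rewrite /q' => /negbTE-> /negbTE->.
  have nq' : null_prob q' = null_prob q.
    by apply: (null_prob_spread ij); rewrite ?q'i ?q'j.
  apply: (@le_trans _ _ (survival q' c m finset.set0)); last first.
    by apply: (survival_spread ij); rewrite ?q'i ?q'j ?inE.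
  apply: IHk; last first.
  - by move: nq'; rewrite /null_prob => /addrI/oppr_inj ->.
  - by rewrite nq'.
  - move=> l; rewrite /q'; case: ifP => _; last case: ifP => // _.
      by case/andP: hx => /(le_trans (q0 i)).
    by case/andP: hy => /(le_trans (q0 i)).
  apply: leq_trans card_q; apply: proper_card; apply/properP; split.
    apply/fintype.subsetP => l; rewrite !inE.
    have [->|li] := eqVneq l i; first by rewrite (lt_eqF qi).
    have [->|lj] := eqVneq l j; first by rewrite (gt_eqF qj).
    by rewrite q'E.
  case/orP: xymu => h; [exists i | exists j]; rewrite !inE ?q'i ?q'j ?h //.
    by rewrite (lt_eqF qi).
  by rewrite (gt_eqF qj).
(* The coordinate closer to [mu] is set to [mu]; the other becomes [q i + q j - mu], which stays
   between [q i] and [q j] because [q i < mu < q j]. *)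
have [h|h] := leP (q i + q j) (mu + mu).
  apply: (step (q i + q j - mu) mu); rewrite ?eqxx ?orbT //; lra.
apply: (step mu (q i + q j - mu)); rewrite ?eqxx ?orbT //; lra.
Qed.

End Survival.

(** * The law of the collection time in terms of the survival function *)

Section Draws.
Variables (R : realType) (n : nat) (q : 'I_n -> R).
Variables (d : measure_display) (Omega : measurableType d).
Variables (P : probability Omega R) (X : nat -> Omega -> 'I_n.+1).

(** Written as an intersection over a duplicate-free list of times, the form to which
    [mutually_independent] applies directly. *)
Definition cylinder (s : seq 'I_n.+1) : set Omega :=
  \bigcap_(k in [set` iota 0 (size s)]) (X k @^-1` [set nth ord0 s k]).

Lemma cylinderP s w :
  cylinder s w <-> forall k, (k < size s)%N -> X k w = nth ord0 s k.
Proof.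
split=> h k; first by move=> ks; apply: h; rewrite /= mem_iota.
by rewrite /= mem_iota => /h.
Qed.

Lemma cylinder_rcons s j :
  cylinder (rcons s j) = cylinder s `&` X (size s) @^-1` [set j].
Proof.
apply/seteqP; split=> w.
  move/cylinderP; rewrite size_rcons => h; split.
    by apply/cylinderP => k ks; rewrite h ?nth_rcons ?ks // ltnS ltnW.
  by rewrite /= h // nth_rcons ltnn eqxx.
case=> /cylinderP h /= hj; apply/cylinderP => k; rewrite size_rcons ltnS.
rewrite leq_eqVlt nth_rcons => /predU1P[->|ks]; first by rewrite ltnn eqxx.
by rewrite ks h.
Qed.

Definition seen (s : seq 'I_n.+1) : {set 'I_n} :=
  [set i | lift ord0 i \in s]%SET.

Lemma collected_cylinder s w : cylinder s w -> collected X (size s) w = seen s.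
Proof.
move=> /cylinderP h; apply/setP => i; rewrite !inE.
apply/existsP/idP => [[k /eqP <-]|/(nthP ord0)[k ks kE]].
  by rewrite h // mem_nth.
by exists (Ordinal ks); rewrite /= h // kE.
Qed.

Lemma seen_rcons0 s : seen (rcons s ord0) = seen s.
Proof. by apply/setP => i; rewrite !inE mem_rcons inE eq_sym eq_liftF. Qed.

Lemma seen_rcons_lift s i : seen (rcons s (lift ord0 i)) = (i |: seen s)%SET.
Proof.
by apply/setP => k; rewrite !inE mem_rcons inE (inj_eq lift_inj).
Qed.

Hypothesis draws : coupon_draws P q X.

Lemma measurable_cylinder s : measurable (cylinder s).
Proof.
case: draws => mX _ _; apply: fin_bigcap_measurable; first exact: finite_seq.
by move=> k _; apply: mX.
Qed.

Lemma probability_cylinder s :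
  P (cylinder s) = (\prod_(j <- s) coupon_prob q j)%:E.
Proof.
case: draws => _ PX indep.
rewrite /cylinder (indep _ (fun k => [set nth ord0 s k])) ?iota_uniq //.
rewrite (eq_bigr (fun k => (coupon_prob q (nth ord0 s k))%:E)) => [|k _]; last first.
  exact: PX.
by rewrite prodEFin [in RHS](big_nth ord0) /index_iota subn0.
Qed.

Definition uncollected (c t : nat) : set Omega :=
  [set w | (#|collected X t w| < c)%N].

(** Induction on [m] for all prefixes [s]: conditioning on the next draw reproduces the recursion of
    [survival]. Measurability is carried along because additivity over the next draw needs it. *)
Lemma cylinder_uncollected c m s :
  measurable (cylinder s `&` uncollected c (size s + m)) /\
  P (cylinder s `&` uncollected c (size s + m)) =
    ((\prod_(j <- s) coupon_prob q j) * survival q c m (seen s))%:E.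
Proof.
elim: m s => [|m IHm] s.
  (* On the cylinder the collected set is [seen s], so the event is the whole cylinder or empty. *)
  rewrite addn0 /=; have [sc|sc] := ltnP #|seen s| c.
    have -> : cylinder s `&` uncollected c (size s) = cylinder s.
      by apply/setIidPl => w /collected_cylinder; rewrite /uncollected /= => ->.
    rewrite mulr1; split; first exact: measurable_cylinder.
    exact: probability_cylinder.
  have -> : cylinder s `&` uncollected c (size s) = set0.
    apply/seteqP; split=> // w [/collected_cylinder].
    by rewrite /uncollected /= => ->; rewrite ltnNge sc.
  by rewrite mulr0 measure0.
(* The disjoint pieces according to the value [j] of the draw that follows the prefix [s]. *)
pose F j := cylinder (rcons s j) `&` uncollected c (size (rcons s j) + m).
have sizeE j : (size (rcons s j) + m = size s + m.+1)%N.
  by rewrite size_rcons addSnnS.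
have FE : cylinder s `&` uncollected c (size s + m.+1) = \bigcup_(j in setT) F j.
  apply/seteqP; split=> w.
    move=> [sw cw]; exists (X (size s) w) => //.
    by rewrite /F sizeE cylinder_rcons.
  by move=> [j _]; rewrite /F sizeE cylinder_rcons => -[[]].
have mF j : measurable (F j) by case: (IHm (rcons s j)).
rewrite FE; split; first exact: fin_bigcup_measurable.
have trivF : trivIset setT F.
  move=> j j' _ _ [w []]; rewrite /F !cylinder_rcons => -[[_ <-] _].
  by move=> [[_ <-] _].
rewrite (measure_fin_bigcup _ finite_finset trivF) //.
rewrite (fsbig_finite _ _ finite_finset) /=.
rewrite (_ : \sum_(i <- _) _ = \sum_(j < n.+1) P (F j))%E; last first.
  apply: perm_big; apply: uniq_perm; rewrite ?index_enum_uniq ?finmap.fset_uniq //.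
  move=> j; rewrite mem_index_enum in_fset_set; last exact: finite_finset.
  exact: in_setT.
rewrite (eq_bigr (fun j => ((\prod_(k <- s) coupon_prob q k) *
  (coupon_prob q j * survival q c m (seen (rcons s j))))%:E)) => [|j _]; last first.
  by rewrite (IHm _).2 big_rcons /= mulrA.
rewrite sumEFin; congr EFin.
(* The null coupon gives the first term of the recursion, the genuine coupons give the sum. *)
rewrite big_ord_recl seen_rcons0 mulrDr mulr_sumr /coupon_prob unlift_none; congr (_ + _).
by apply: eq_bigr => i _; rewrite seen_rcons_lift liftK.
Qed.

Lemma probability_uncollected c m :
  P (uncollected c m) = (survival q c m finset.set0)%:E.
Proof.
have [_] := cylinder_uncollected c m [::].
rewrite big_nil mul1r (_ : cylinder [::] = setT) ?setTI => [->|].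
  by congr (survival _ _ _ _)%:E; apply/setP => i; rewrite !inE.
by apply/seteqP; split=> // w _; apply/cylinderP.
Qed.

(** The collection time is a natural number or infinite, so it exceeds [t] exactly when it exceeds
    the integer part of [t]. *)
Lemma collection_time_gt c (t : R) : 0 <= t ->
  [set w | (t%:E < collection_time R c X w)%E] = uncollected c (Num.truncn t).
Proof.
move=> t0; have /andP[let_t lt_t] := truncn_itv t0.
apply/seteqP; split=> w; rewrite /uncollected /= /collection_time.
  rewrite ltnNge; apply: contraTN => hc; rewrite -leNgt.
  apply: (@le_trans _ _ ((Num.truncn t)%:R)%:E); last by rewrite lee_fin.
  by apply: ereal_inf_lbound; exists (Num.truncn t).
move=> hc; apply: (@lt_le_trans _ _ ((Num.truncn t).+1%:R)%:E).
  by rewrite lte_fin.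
apply: le_ereal_inf_tmp => _ [k /= hk <-].
(* The collected set only grows with time, so [c] coupons at a time [k] up to the integer part of
   [t] would contradict [hc]. *)
rewrite lee_fin ler_nat ltnNge; apply: contraL hc => kt; rewrite -leqNgt.
apply: leq_trans hk _; apply/subset_leq_card/fintype.subsetP => i.
rewrite !inE => /existsP[l li].
by apply/existsP; exists (widen_ord kt l).
Qed.

Lemma collection_time_ge0 c w : (0 <= collection_time R c X w)%E.
Proof. by apply: le_ereal_inf_tmp => _ [k _ <-]; rewrite lee_fin. Qed.

Lemma probability_collection_time_gt c (t : R) :
  P [set w | (t%:E < collection_time R c X w)%E] =
  (if 0 <= t then survival q c (Num.truncn t) finset.set0 else 1)%:E.
Proof.
have [t0|t0] := leP 0 t.
  by rewrite collection_time_gt // probability_uncollected.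
rewrite (_ : [set w | _] = setT) ?probability_setT //.
apply/seteqP; split=> // w _ /=.
by apply: lt_le_trans (collection_time_ge0 c w); rewrite lte_fin.
Qed.

End Draws.

(** * Stochastic comparison of the collection times *)

Lemma st_le_collection_time (R : realType) (n c : nat) (q q' : 'I_n -> R)
    (d : measure_display) (Omega : measurableType d)
    (P : probability Omega R) (X : nat -> Omega -> 'I_n.+1)
    (d' : measure_display) (Omega' : measurableType d')
    (P' : probability Omega' R) (X' : nat -> Omega' -> 'I_n.+1) :
    coupon_draws P q X -> coupon_draws P' q' X' ->
    (forall m, survival q c m finset.set0 <= survival q' c m finset.set0) ->
  st_le P (collection_time R c X) P' (collection_time R c X').
Proof.
move=> dX dX' le_qq' t.
rewrite (probability_collection_time_gt dX) (probability_collection_time_gt dX').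
by rewrite lee_fin; case: ifP.
Qed.

Theorem theorem3 (R : realType) (n : nat) (p : 'I_n -> R)
    (n_ge1 : (1 <= n)%N)
    (p_in01 : forall i : 'I_n, 0 < p i < 1)
    (sum_p : \sum_(i < n) p i < 1)
    (du : measure_display) (Omegau : measurableType du)
    (Pu : probability Omegau R) (Xu : nat -> Omegau -> 'I_n.+1)
    (dv : measure_display) (Omegav : measurableType dv)
    (Pv : probability Omegav R) (Xv : nat -> Omegav -> 'I_n.+1)
    (dp : measure_display) (Omegap : measurableType dp)
    (Pp : probability Omegap R) (Xp : nat -> Omegap -> 'I_n.+1)
    (draws_u : coupon_draws Pu (fun _ : 'I_n => 1 / n%:R) Xu)
    (draws_v : coupon_draws Pv (fun _ : 'I_n => (1 - null_prob p) / n%:R) Xv)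
    (draws_p : coupon_draws Pp p Xp) :
  forall c : nat, (1 <= c <= n)%N ->
    st_le Pu (collection_time R c Xu) Pv (collection_time R c Xv) /\
    st_le Pv (collection_time R c Xv) Pp (collection_time R c Xp).
Proof.
move=> c _.
have n0 : n%:R != 0 :> R by rewrite pnatr_eq0 -lt0n.
have p0 i : 0 <= p i by case/andP: (p_in01 i) => /ltW.
have nullp : 1 - null_prob p = \sum_(i < n) p i by rewrite /null_prob subKr.
split.
  apply: (st_le_collection_time draws_u draws_v) => m.
  (* Each coordinate of v is at most the matching one of u since the [p i] sum to less than 1; the
     null probability of u is 0. *)
  apply: survival_le_prob => [i|].
    rewrite nullp mulr_ge0 ?invr_ge0 ?sumr_ge0 //=.
    by rewrite ler_wpM2r ?invr_ge0 // ltW.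
  rewrite /null_prob sumr_const card_ord -[_ *+ n]mulr_natr.
  by rewrite divfK // subrr.
apply: (st_le_collection_time draws_v draws_p) => m.
(* The common value of v is the mean of the [p i]. *)
apply: survival_uniform => //; first by rewrite subr_ge0 ltW.
by rewrite nullp mulrC divfK.
Qed.
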